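(* Let $\mathcal{F}$ be the current (finite) front set, let $\hat{\mathcal{F}}=(\mathcal{V},\mathcal{E})$ be its associated graph of candidate elements, and let $M$ be the prescribed maximal number of iterations. Then the independent set $\mathcal{V}_s=\mathcal{A}_1\cup\dots\cup\mathcal{A}_n$ returned by the consistent parallel MIS algorithm is independent of the decomposition $\mathcal{V}=\mathcal{V}_1\cup\dots\cup\mathcal{V}_n$ and of the number $n$ of processors. That is, if $\mathcal{V}=\mathcal{V}_1\cup\dots\cup\mathcal{V}_n$ and $\mathcal{V}=\tilde{\mathcal{V}}_1\cup\dots\cup\tilde{\mathcal{V}}_m$ are two decompositions of $\mathcal{V}$ induced by admissible decompositions of $\mathcal{F}$, and the algorithm is run on each of them with the same $M$, then the two returned sets $\mathcal{V}_s$ are equal.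
   Context: Fronts and decompositions. $\mathcal{F}$ is a finite set of fronts (edges in $\mathbb{R}^2$ or triangles in $\mathbb{R}^3$). A Cartesian background mesh consists of boxes $b_0,b_1,\dots$ numbered along a space-filling curve, and each front is embedded in (assigned to) one box. An admissible decomposition $\mathcal{F}=\mathcal{F}_1\cup\dots\cup\mathcal{F}_n$ into disjoint subsets is obtained by distributing the boxes into $n$ disjoint groups $\mathcal{B}_1,\dots,\mathcal{B}_n$ such that $b_k\in\mathcal{B}_i$, $b_l\in\mathcal{B}_j$, $i<j$ imply $k<l$, and letting $\mathcal{F}_i$ be the fronts whose box lies in $\mathcal{B}_i$. The local index $\mathrm{Id}(f,k;n)$ numbers the fronts of $\mathcal{F}_k$ from $0$ to $|\mathcal{F}_k|-1$ in ascending order of box index. The global index of $f\in\mathcal{F}_k$ is $\mathrm{GI}(f)=\mathrm{Id}(f,k;n)+\sum_{i=1}^{k-1}|\mathcal{F}_i|$. Standing fact (known property of the space-filling-curve ordering, taken as given): $\mathrm{GI}(f)$ does not depend on the decomposition, i.e. if $f\in\mathcal{F}_k$ in one admissible decomposition into $n$ parts and $f\in\tilde{\mathcal{F}}_l$ in another into $m$ parts, then $\mathrm{Id}(f,k;n)+\sum_{i=1}^{k-1}|\mathcal{F}_i|=\mathrm{Id}(f,l;m)+\sum_{i=1}^{l-1}|\tilde{\mathcal{F}}_i|$. Graph. For each front $f_i\in\mathcal{F}$ for which an optimal potential advancing point $p_i$ exists, the pair $v_i=(f_i,p_i)$ (a candidate new element) is a vertex in $\mathcal{V}$; there is at most one vertex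 per front. Two distinct vertices $v_i=(f_i,p_i)$, $v_j=(f_j,p_j)$ are joined by an edge of $\mathcal{E}$ if and only if $\mathrm{dist}(p_i,p_j)\le h_i+h_j$, where $h_i,h_j>0$ are the local mesh scales near $f_i,f_j$. $\mathcal{N}(v)$ denotes the set of vertices joined to $v$ by an edge. A set of vertices is independent if no two of its members are joined by an edge. A decomposition of $\mathcal{F}$ induces the disjoint decomposition $\mathcal{V}=\mathcal{V}_1\cup\dots\cup\mathcal{V}_n$, with $(f,p)\in\mathcal{V}_i$ iff $f\in\mathcal{F}_i$. Put $\mathcal{V}_i^\delta=\mathcal{V}_i\cup\bigcup_{v\in\mathcal{V}_i}\mathcal{N}(v)$. Consistent parallel MIS algorithm (processor $i$ handles $\mathcal{V}_i$; all processors perform each step synchronously). At all times $\mathcal{V}_i=\mathcal{A}_i\cup\mathcal{U}_i\cup\mathcal{P}_i$ and $\mathcal{V}_i^\delta=\mathcal{A}_i^\delta\cup\mathcal{U}_i^\delta\cup\mathcal{P}_i^\delta$ are disjoint partitions (accepted, discarded, pending); moving a vertex into one class removes it from its former class. Initialization: $\mathcal{A}_i=\mathcal{A}_i^\delta=\emptyset$, $\mathcal{U}_i=\mathcal{U}_i^\delta=\emptyset$, $\mathcal{P}_i=\mathcal{V}_i$, $\mathcal{P}_i^\delta=\mathcal{V}_i^\delta$ for $i=1,\dots,n$; for $v=(f,p)$ set $ID(v)=\mathrm{GI}(f)$; $its=0$. While $its<M$: Step 1. Each $v\in\mathcal{P}_i$ such that $ID(v)\le ID(\hat v)$ for all $\hat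 v\in\mathcal{N}(v)\cap\mathcal{P}_i^\delta$ is moved into a temporary set $\mathcal{T}_i$. Step 2. For each $v_t\in\mathcal{T}_i$, move $v_t$ into $\mathcal{A}_i$ and move all vertices of $\mathcal{N}(v_t)\cap(\mathcal{A}_i^\delta\cup\mathcal{P}_i^\delta)$ into $\mathcal{U}_i^\delta$; update $\mathcal{U}_i$ correspondingly. Step 3. By communication, each vertex of $\mathcal{U}_i^\delta\setminus\mathcal{U}_i$ is put into $\mathcal{U}_j$ on the processor $j$ that owns it, and all other subsets are updated in the same manner (so that the classes of the vertices in each $\mathcal{V}_i^\delta$ agree with their classes on the owning processors). Step 4. If $|\mathcal{P}_1\cup\dots\cup\mathcal{P}_n|>0$, set $its:=its+1$ and return to Step 1 (subject to $its<M$); otherwise stop. Return $\mathcal{A}_i,\mathcal{U}_i,\mathcal{P}_i$ and $\mathcal{V}_s=\mathcal{A}_1\cup\dots\cup\mathcal{A}_n$. *)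

(* Defs.v *)
From mathcomp Require Import all_boot all_order all_algebra.
From mathcomp Require Import finmap reals.

Set Implicit Arguments.
Unset Strict Implicit.
Unset Printing Implicit Defensive.

Import Order.TTheory GRing.Theory Num.Theory.

Local Open Scope ring_scope.

(* The Euclidean distance; the library norm on 'rV[R]_d is the sup norm. *)
Definition dist (R : realType) (d : nat) (p q : 'rV[R]_d) : R :=
  Num.sqrt (\sum_(i < d) (p ord0 i - q ord0 i) ^+ 2).

(* A (d-1)-simplex of R^d, given by its d corners (the rows of A): an edge for
   d = 2, a triangle for d = 3. The corners are affinely independent, i.e. their
   homogeneous coordinates are linearly independent. *)
Definition front (R : realType) (d : nat) : Type :=
  {A : 'M[R]_d | row_free (row_mx (const_mx 1 : 'cV[R]_d) A)}.

(* The boxes b_0, ..., b_(N-1) are represented by their indices along the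
   space-filling curve. Groups may be empty. *)
Record decomposition (N n : nat) : Type := Decomposition {
  group :> 'I_n -> {set 'I_N};
  group_cover : \bigcup_(i < n) group i = [set: 'I_N];
  group_disjoint : forall i j : 'I_n, i != j -> [disjoint group i & group j];
  group_order : forall (i j : 'I_n) (k l : 'I_N),
    k \in group i -> l \in group j -> (i < j)%N -> (k < l)%N
}.

Definition front_part (R : realType) (d N : nat) (F : {fset front R d})
    (box : front R d -> 'I_N) (n : nat) (D : decomposition N n) (k : 'I_n) :
    {fset front R d} :=
  [fset f in F | box f \in D k]%fset.

(* Fronts lying in the same box may be numbered in any order. *)
Definition numbers_ascending (R : realType) (d N : nat)
    (box : front R d -> 'I_N) (S : {fset front R d}) (num : front R d -> nat) :
    Prop :=
  [/\ {in S, forall f, (num f < #|` S|)%N},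
      {in S &, injective num} &
      {in S &, forall f g, (box f < box g)%N -> (num f < num g)%N}].

(* A choice of the local indices Id(f,k;n) for every decomposition. *)
Definition local_index (R : realType) (d N : nat) : Type :=
  forall n : nat, decomposition N n -> front R d -> 'I_n -> nat.

Definition is_local_index (R : realType) (d N : nat) (F : {fset front R d})
    (box : front R d -> 'I_N) (Id : local_index R d N) : Prop :=
  forall (n : nat) (D : decomposition N n) (k : 'I_n),
    numbers_ascending box (front_part F box D k) (fun f => Id n D f k).

Definition shifted_index (R : realType) (d N : nat) (F : {fset front R d})
    (box : front R d -> 'I_N) (Id : local_index R d N)
    (n : nat) (D : decomposition N n) (f : front R d) (k : 'I_n) : nat :=
  (Id n D f k + \sum_(i < n | (i < k)%N) #|` front_part F box D i|)%N.

(* For f \in F the part containing f exists and is unique; 0 is a dummy value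
   for f \notin F. *)
Definition GI (R : realType) (d N : nat) (F : {fset front R d})
    (box : front R d -> 'I_N) (Id : local_index R d N)
    (n : nat) (D : decomposition N n) (f : front R d) : nat :=
  if [pick k | f \in front_part F box D k] is Some k
  then shifted_index F box Id D f k else 0%N.

Definition GI_decomposition_invariant (R : realType) (d N : nat)
    (F : {fset front R d}) (box : front R d -> 'I_N) (Id : local_index R d N) :
    Prop :=
  forall (n m : nat) (D : decomposition N n) (D' : decomposition N m)
    (f : front R d) (k : 'I_n) (l : 'I_m),
    f \in front_part F box D k -> f \in front_part F box D' l ->
    shifted_index F box Id D f k = shifted_index F box Id D' f l.

(* [adv f] is the optimal potential advancing point of f, if there is one. *)
Definition vertices (R : realType) (d : nat) (F : {fset front R d})
    (adv : front R d -> option ('rV[R]_d)) :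
    {fset front R d * 'rV[R]_d} :=
  [fset v in pmap (fun f => omap (pair f) (adv f)) (enum_fset F)]%fset.

Definition edge (R : realType) (d : nat) (F : {fset front R d})
    (adv : front R d -> option ('rV[R]_d)) (h : front R d -> R) :
    rel (vertices F adv) :=
  fun v w => (v != w) &&
    (dist (val v).2 (val w).2 <= h (val v).1 + h (val w).1).

Definition vertex_part (R : realType) (d N : nat) (F : {fset front R d})
    (box : front R d -> 'I_N) (adv : front R d -> option ('rV[R]_d))
    (n : nat) (D : decomposition N n) (i : 'I_n) : {set vertices F adv} :=
  [set v | (val v).1 \in front_part F box D i].

Arguments edge {R d} F adv h.
Arguments vertex_part {R d N} F box adv {n} D i.

Record classes (V : finType) : Type := Classes {
  accepted : {set V};
  discarded : {set V};
  pending : {set V}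
}.

Definition accept (V : finType) (X : {set V}) (c : classes V) : classes V :=
  Classes (accepted c :|: X) (discarded c :\: X) (pending c :\: X).

Definition discard (V : finType) (X : {set V}) (c : classes V) : classes V :=
  Classes (accepted c :\: X) (discarded c :|: X) (pending c :\: X).

Definition remove_pending (V : finType) (X : {set V}) (c : classes V) :
    classes V :=
  Classes (accepted c) (discarded c) (pending c :\: X).

(* What one processor stores: the classes of its own vertices (A_i, U_i, P_i)
   and those of its extended vertex set (A_i^delta, U_i^delta, P_i^delta). *)
Record proc_state (V : finType) : Type := ProcState {
  own : classes V;
  ext : classes V
}.

Definition state (V : finType) (n : nat) : Type := 'I_n -> proc_state V.

Definition nbhd (V : finType) (e : rel V) (v : V) : {set V} := [set w | e v w].

Definition ext_part (V : finType) (e : rel V) (X : {set V}) : {set V} :=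
  X :|: \bigcup_(v in X) nbhd e v.

Definition init_state (V : finType) (e : rel V) (n : nat)
    (part : 'I_n -> {set V}) : state V n :=
  fun i => ProcState (Classes set0 set0 (part i))
                     (Classes set0 set0 (ext_part e (part i))).

Definition selected (V : finType) (e : rel V) (ID : V -> nat)
    (s : proc_state V) : {set V} :=
  [set v in pending (own s) |
    [forall w in nbhd e v :&: pending (ext s), (ID v <= ID w)%N]].

Definition select (V : finType) (T : {set V}) (s : proc_state V) :
    proc_state V :=
  ProcState (remove_pending T (own s)) (remove_pending T (ext s)).

Definition process_selected (V : finType) (e : rel V) (X : {set V})
    (s : proc_state V) (v : V) : proc_state V :=
  let D := nbhd e v :&: (accepted (ext s) :|: pending (ext s)) in
  ProcState (discard (D :&: X) (accept [set v] (own s)))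
            (discard D (accept [set v] (ext s))).

(* The update on the processor owning X, before communication. The selected
   vertices are processed one after the other, as V is enumerated; when ID is
   injective they are pairwise non-adjacent, so the order is immaterial. *)
Definition local_step (V : finType) (e : rel V) (ID : V -> nat) (X : {set V})
    (s : proc_state V) : proc_state V :=
  let T := selected e ID s in
  foldl (process_selected e X) (select T s) (enum T).

(* The owners first receive the discarded vertices, then every extended
   class is refreshed from the owners' classes. *)
Definition communicate (V : finType) (e : rel V) (n : nat)
    (part : 'I_n -> {set V}) (s : state V n) : state V n :=
  let sent := \bigcup_(i < n) (discarded (ext (s i)) :\: discarded (own (s i))) in
  let o j := discard (sent :&: part j) (own (s j)) in
  fun i =>
    let Xd := ext_part e (part i) in
    ProcState (o i)
      (Classes (Xd :&: \bigcup_(j < n) accepted (o j))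
               (Xd :&: \bigcup_(j < n) discarded (o j))
               (Xd :&: \bigcup_(j < n) pending (o j))).

Definition iteration (V : finType) (e : rel V) (ID : V -> nat) (n : nat)
    (part : 'I_n -> {set V}) (s : state V n) : state V n :=
  communicate e part (fun i => local_step e ID (part i) (s i)).

(* [M] is the number of iterations that are still allowed, M - its. *)
Fixpoint run (V : finType) (e : rel V) (ID : V -> nat) (n : nat)
    (part : 'I_n -> {set V}) (M : nat) (s : state V n) : state V n :=
  if M is M'.+1 then
    let s' := iteration e ID part s in
    if (0 < #|\bigcup_(i < n) pending (own (s' i))|)%N
    then run e ID part M' s' else s'
  else s.

Definition parallel_MIS (V : finType) (e : rel V) (ID : V -> nat) (n : nat)
    (part : 'I_n -> {set V}) (M : nat) : {set V} :=
  \bigcup_(i < n) accepted (own (run e ID part M (init_state e part) i)).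

Definition returned_set (R : realType) (d N : nat) (F : {fset front R d})
    (box : front R d -> 'I_N) (Id : local_index R d N)
    (adv : front R d -> option ('rV[R]_d)) (h : front R d -> R) (M : nat)
    (n : nat) (D : decomposition N n) : {set vertices F adv} :=
  parallel_MIS (edge F adv h) (fun v => GI F box Id D (val v).1)
    (vertex_part F box adv D) M.

(* Main.v *)
(* Every iteration of the distributed algorithm acts on the union of the local
   classes as one iteration on a single processor that owns the whole graph.
   Indeed a processor sees all neighbours of its own vertices, so it selects
   exactly those of them that are local minima of ID among all pending
   vertices. ID is injective, hence the selected vertices are pairwise
   non-adjacent and the order in which they are processed is immaterial; the
   communication then delivers to each owner the discards that were caused by
   vertices of other processors. It remains to see that ID does not depend on
   the decomposition, which is the invariance of the global index, and that it
   is injective, which follows by computing it in the decomposition into one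
   part. *)
Require Import Defs.
From mathcomp Require Import all_boot all_order all_algebra.
From mathcomp Require Import finmap reals.

Set Implicit Arguments.
Unset Strict Implicit.
Unset Printing Implicit Defensive.

Import Order.TTheory GRing.Theory Num.Theory.

Local Open Scope ring_scope.

(** * Global, single-processor form of the algorithm *)

Definition restrict (V : finType) (X : {set V}) (c : classes V) : classes V :=
  Classes (X :&: accepted c) (X :&: discarded c) (X :&: pending c).

Definition nbrs (V : finType) (e : rel V) (T : {set V}) : {set V} :=
  \bigcup_(v in T) nbhd e v.

Definition independent (V : finType) (e : rel V) (T : {set V}) : Prop :=
  {in T &, forall v w, ~~ e v w}.

(** Simultaneous form of Step 2: for independent [T] it agrees with treating the vertices of [T] one
    at a time, in any order. *)
Definition settle (V : finType) (e : rel V) (T : {set V}) (c : classes V) :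
    classes V :=
  Classes ((accepted c :|: T) :\: nbrs e T)
          ((discarded c :\: T) :|: nbrs e T :&: (accepted c :|: pending c))
          ((pending c :\: T) :\: nbrs e T).

Definition local_minima (V : finType) (e : rel V) (ID : V -> nat)
    (c : classes V) : {set V} :=
  [set v in pending c |
    [forall w in nbhd e v :&: pending c, (ID v <= ID w)%N]].

(** Invariant of the iteration. Each communication sends old discards again; this is harmless
    because a discarded vertex is not pending and so is never selected. *)
Definition consistent (V : finType) (c : classes V) : Prop :=
  [disjoint discarded c & accepted c :|: pending c].

(** The shape of a state after communication: all local classes are cut out of the same global
    ones. *)
Definition distribute (V : finType) (e : rel V) (n : nat)
    (part : 'I_n -> {set V}) (c : classes V) : state V n :=
  fun i => ProcState (restrict (part i) c) (restrict (ext_part e (part i)) c).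

Fixpoint global_run (V : finType) (e : rel V) (ID : V -> nat) (M : nat)
    (c : classes V) : classes V :=
  if M is M'.+1 then
    let c' := settle e (local_minima e ID c) c in
    if (0 < #|pending c'|)%N then global_run e ID M' c' else c'
  else c.

(** * Successive and simultaneous processing of independent vertices *)

Section Graph.

Variables (V : finType) (e : rel V).

Lemma classes_eq (c c' : classes V) :
  accepted c = accepted c' -> discarded c = discarded c' ->
  pending c = pending c' -> c = c'.
Proof. by case: c c' => [A U P] [A' U' P'] /= -> -> ->. Qed.

Lemma nbrsP (T : {set V}) (w : V) :
  reflect (exists2 v, v \in T & e v w) (w \in nbrs e T).
Proof.
apply: (iffP bigcupP) => [[v vT]|[v vT ev]]; first by rewrite inE; exists v.
by exists v; rewrite // inE.
Qed.

Lemma nbrs_set0 : nbrs e set0 = set0.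
Proof. by rewrite /nbrs big_set0. Qed.

Lemma nbrsU1 (v : V) (T : {set V}) : nbrs e (v |: T) = nbhd e v :|: nbrs e T.
Proof. by rewrite /nbrs bigcup_setU big_set1. Qed.

Lemma nbrsS (S T : {set V}) : S \subset T -> nbrs e S \subset nbrs e T.
Proof.
by move=> /subsetP sST; apply/subsetP => w /nbrsP[v vS ev];
   apply/nbrsP; exists v; rewrite // sST.
Qed.

Lemma independentS (S T : {set V}) :
  S \subset T -> independent e T -> independent e S.
Proof. by move=> /subsetP sST indT v w vS wS; apply: indT; apply: sST. Qed.

Lemma independent_nbrs (T : {set V}) (w : V) :
  independent e T -> w \in T -> w \notin nbrs e T.
Proof.
by move=> indT wT; apply/nbrsP => -[v vT]; apply/negP; apply: indT.
Qed.

Lemma settle_set0 (c : classes V) : settle e set0 c = c.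
Proof.
by apply: classes_eq; rewrite /= nbrs_set0 ?set0I ?setU0 !setD0.
Qed.

Lemma settleU1 (v : V) (T : {set V}) (c : classes V) :
  independent e (v |: T) ->
  settle e (v |: T) c =
  settle e T (discard (nbhd e v :&: (accepted c :|: pending c))
                      (accept [set v] c)).
Proof.
move=> ind.
(* Independence keeps [v |: T] out of both neighbourhoods, so no acceptance is undone by a later
   discard. The classes then agree by a truth table at each [w]. *)
have key w : [&& (w \in v |: T) ==> (w \notin nbhd e v) &
                 (w \in v |: T) ==> (w \notin nbrs e T)].
  apply/andP; split; apply/implyP => wT;
    by have := independent_nbrs ind wT; rewrite nbrsU1 inE negb_or => /andP[].
apply: classes_eq; apply/setP => w; have := key w; rewrite /= nbrsU1 !inE;
  case: (w == v); case: (w \in T); case: (e v w); case: (w \in nbrs e T);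
  case: (w \in accepted c); case: (w \in discarded c);
  by case: (w \in pending c).
Qed.

(** Since [v] belongs to [X], cutting the discards down to [X] keeps the own classes equal to the
    restriction of the extended ones; this invariant carries the fold. *)
Lemma process_selected_restrict (X : {set V}) (c : classes V) (v : V) :
  v \in X ->
  let c' := discard (nbhd e v :&: (accepted c :|: pending c))
                    (accept [set v] c) in
  process_selected e X (ProcState (restrict X c) c) v =
  ProcState (restrict X c') c'.
Proof.
move=> vX /=; congr ProcState.
apply: classes_eq; apply/setP => w; rewrite /= !inE;
  have [->|_] := eqVneq w v; rewrite ?vX;
  case: (_ \in X); case: (e _ _); case: (_ \in accepted c);
  case: (_ \in discarded c); by case: (_ \in pending c).
Qed.

Lemma foldl_process_selected (X : {set V}) (l : seq V) (c : classes V) :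
  {subset l <= X} -> independent e [set:: l] ->
  foldl (process_selected e X) (ProcState (restrict X c) c) l =
  ProcState (restrict X (settle e [set:: l] c)) (settle e [set:: l] c).
Proof.
elim: l c => [|v l IHl] c sub.
  by move=> _; rewrite set_nil settle_set0.
rewrite set_cons => ind; rewrite [foldl _ _ _]/= process_selected_restrict.
  rewrite IHl ?settleU1 //.
    by move=> w wl; apply: sub; rewrite inE wl orbT.
  exact: independentS (subsetUr _ _) ind.
by apply: sub; rewrite mem_head.
Qed.

(** The early removal of [T] could only affect discards of vertices of [T] itself, and independence
    excludes these. *)
Lemma settle_remove_pending (T : {set V}) (c : classes V) :
  independent e T -> settle e T (remove_pending T c) = settle e T c.
Proof.
move=> ind; apply: classes_eq; apply/setP => w;
  have := @independent_nbrs T w ind; rewrite /= !inE; case: (w \in T) => // H.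
by rewrite (negbTE (H isT)).
Qed.

(** * Selection and the local step *)

Variable ID : V -> nat.

Lemma local_step_restrict (X : {set V}) (c : classes V) :
  let T := selected e ID (ProcState (restrict X c) c) in
  independent e T ->
  local_step e ID X (ProcState (restrict X c) c) =
  ProcState (restrict X (settle e T c)) (settle e T c).
Proof.
move=> T indT; rewrite /local_step -/T /select.
have -> : remove_pending T (own (ProcState (restrict X c) c)) =
          restrict X (remove_pending T c).
  by apply: classes_eq; rewrite //= setIDA.
have enumT : [set:: enum T] = T by apply/setP => w; rewrite inE mem_enum.
rewrite foldl_process_selected ?enumT ?settle_remove_pending //.
by move=> w; rewrite mem_enum inE => /andP[/=]; rewrite inE => /andP[].
Qed.

Lemma nbhd_sub_ext_part (X : {set V}) (v : V) :
  v \in X -> nbhd e v \subset ext_part e X.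
Proof.
move=> vX; apply: subset_trans (subsetUr _ _).
exact: (bigcup_sup v).
Qed.

Lemma restrict_ext_part (X : {set V}) (c : classes V) :
  restrict X (restrict (ext_part e X) c) = restrict X c.
Proof. by apply: classes_eq; rewrite /= setIA (setIidPl (subsetUl _ _)). Qed.

(** All neighbours of a vertex of [X] lie in the extended part, so the local test for a minimum is
    the global one. *)
Lemma selected_restrict (X : {set V}) (c : classes V) :
  selected e ID (ProcState (restrict X c) (restrict (ext_part e X) c)) =
  X :&: local_minima e ID c.
Proof.
apply/setP => v; rewrite !inE /=; have [vX|//] := boolP (v \in X).
by rewrite setIA (setIidPl (nbhd_sub_ext_part vX)).
Qed.

Lemma consistent_settle (T : {set V}) (c : classes V) :
  consistent c -> consistent (settle e T c).
Proof.
rewrite /consistent -!setI_eq0 => /eqP/setP cons; apply/eqP/setP => w.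
have := cons w; rewrite /= !inE; case: (w \in T); case: (w \in nbrs e T);
  case: (w \in accepted c); case: (w \in discarded c);
  by case: (w \in pending c).
Qed.

Hypotheses (e_irr : irreflexive e) (e_sym : symmetric e).
Hypothesis ID_inj : injective ID.

(** Adjacent local minima would have equal [ID], hence coincide, and [e] has no loops. *)
Lemma independent_local_minima (c : classes V) :
  independent e (local_minima e ID c).
Proof.
move=> v w; rewrite !inE => /andP[vP /forall_inP vmin] /andP[wP /forall_inP wmin].
apply/negP => evw.
have vw : v = w.
  apply: ID_inj; apply/eqP; rewrite eqn_leq vmin ?inE ?evw ?wP //.
  by rewrite wmin // !inE e_sym evw.
by rewrite vw e_irr in evw.
Qed.

(** * Distributed iterations as global ones *)

Variables (n : nat) (part : 'I_n -> {set V}).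
Hypothesis part_cover : \bigcup_(i < n) part i = [set: V].
Hypothesis part_disjoint :
  forall i j : 'I_n, i != j -> [disjoint part i & part j].

Lemma bigcup_part (X : {set V}) : \bigcup_(i < n) (part i :&: X) = X.
Proof. by rewrite -big_distrl /= part_cover setTI. Qed.

Section Iteration.

Variables (c : classes V) (s : state V n).
Hypotheses (cons_c : consistent c) (s_c : s =1 distribute e part c).

Let T := local_minima e ID c.
Let T_ i := part i :&: T.
Let c_ i := settle e (T_ i) (restrict (ext_part e (part i)) c).

Lemma local_step_distribute (i : 'I_n) :
  local_step e ID (part i) (s i) = ProcState (restrict (part i) (c_ i)) (c_ i).
Proof.
rewrite s_c /distribute -[restrict (part i) c]restrict_ext_part.
rewrite local_step_restrict restrict_ext_part selected_restrict //.
exact: independentS (subsetIr _ _) (@independent_local_minima c).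
Qed.

Let sent : {set V} :=
  \bigcup_(i < n) (discarded (c_ i) :\: discarded (restrict (part i) (c_ i))).

(** A sent vertex either was discarded before, hence is not pending and not in [T], or is an
    accepted or pending neighbour of some [T_ i], hence of [T]. *)
Lemma sent_discarded (w : V) : w \in sent -> w \in discarded (settle e T c).
Proof.
case/bigcupP => i _; rewrite !inE => /andP[_ /orP[]].
  case/and3P => _ _ wU; rewrite wU andbT.
  have := disjointFr cons_c wU; rewrite inE => /norP[_ wP].
  by rewrite (negbTE wP).
case/andP => wN; rewrite -andb_orr => /andP[_ ->].
by rewrite (subsetP (nbrsS (subsetIr (part i) T))) // orbT.
Qed.

(** A vertex of [T] adjacent to [w] lies in some [part i]. If [i = j], the owner itself discards
    [w]; otherwise [w] is in the extended part of [i] but not in [part i], so its discard is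
    sent. *)
Lemma discarded_sent (j : 'I_n) (w : V) :
  w \in part j -> w \in nbrs e T -> w \in accepted c :|: pending c ->
  (w \in nbrs e (T_ j)) || (w \in sent).
Proof.
move=> wj /nbrsP[v vT evw] wAP.
have /bigcupP[i _ vi] : v \in \bigcup_(i < n) part i by rewrite part_cover inE.
have wN : w \in nbrs e (T_ i) by apply/nbrsP; exists v; rewrite // inE vi.
have [<-|neq_ij] := eqVneq i j; first by rewrite wN.
apply/orP; right; apply/bigcupP; exists i => //.
have wi : w \in part i = false by apply: (disjointFl (part_disjoint neq_ij)).
have wX : w \in ext_part e (part i).
  by rewrite (subsetP (nbhd_sub_ext_part vi)) // inE.
apply/setDP; split; last by rewrite /= in_setI wi.
by apply/setUP; right; rewrite in_setI wN in_setU /= !in_setI wX -in_setU.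
Qed.

Lemma discard_sent (j : 'I_n) :
  discard (sent :&: part j) (restrict (part j) (c_ j)) =
  restrict (part j) (settle e T c).
Proof.
(* The first two facts say that communication discards neither too much nor too little. *)
have key w : w \in part j ->
  [&& (w \in sent) ==> (w \in discarded (settle e T c)),
      (w \in nbrs e T) && (w \in accepted c :|: pending c) ==>
        (w \in nbrs e (T_ j)) || (w \in sent),
      (w \in nbrs e (T_ j)) ==> (w \in nbrs e T),
      (w \in T) ==> (w \in pending c) && (w \notin nbrs e T) &
      (w \in discarded c) ==> (w \notin accepted c :|: pending c)].
  move=> wj; apply/and5P; split; apply/implyP.
  - exact: sent_discarded.
  - by case/andP; apply: discarded_sent.
  - exact/subsetP/nbrsS/subsetIr.
  - move=> wT; rewrite independent_nbrs ?andbT //; last first.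
      exact: independent_local_minima.
    by move: wT; rewrite inE => /andP[].
  - by move=> wU; rewrite (disjointFr cons_c wU).
have in_T_ w : w \in part j -> (w \in T_ j) = (w \in T).
  by rewrite inE => ->.
have in_ext w : w \in part j -> w \in ext_part e (part j).
  exact/subsetP/subsetUl.
(* The sets become opaque variables, so that [inE] does not unfold them and each class reduces to a
   truth table. *)
rewrite /c_; move: sent T (T_ j) (ext_part _ _) key in_T_ in_ext.
move=> S T' Tj Xd key in_Tj in_Xd.
apply: classes_eq; apply/setP => w;
  have := in_Tj w; have := in_Xd w; have := key w;
  rewrite /= !inE; case: (w \in part j); rewrite ?andbF //= => /(_ isT) key_w;
  move=> /(_ isT) -> /(_ isT) ->; move: key_w;
  case: (w \in S); case: (w \in T'); case: (w \in nbrs e T');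
  case: (w \in nbrs e Tj); case: (w \in accepted c);
  case: (w \in discarded c); by case: (w \in pending c).
Qed.

Lemma iteration_distribute :
  iteration e ID part s =1 distribute e part (settle e T c).
Proof.
move=> i; rewrite /iteration /communicate.
under eq_bigr do rewrite local_step_distribute.
have o_ j : discard (sent :&: part j) (own (local_step e ID (part j) (s j))) =
            restrict (part j) (settle e T c).
  by rewrite local_step_distribute discard_sent.
congr ProcState; first exact: o_.
apply: classes_eq; congr (_ :&: _); rewrite -[RHS]bigcup_part;
  apply: eq_bigr => j _.
- exact (congr1 (@accepted V) (o_ j)).
- exact (congr1 (@discarded V) (o_ j)).
- exact (congr1 (@pending V) (o_ j)).
Qed.

End Iteration.

Lemma run_distribute (M : nat) (c : classes V) (s : state V n) :
  consistent c -> s =1 distribute e part c ->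
  run e ID part M s =1 distribute e part (global_run e ID M c).
Proof.
elim: M c s => [//|M IHM] c s cons_c s_c /=.
have s'_c' := iteration_distribute cons_c s_c.
(* Both runs stop together: the own pending classes unite to the global one. *)
have -> : \bigcup_(i < n) pending (own (iteration e ID part s i)) =
          pending (settle e (local_minima e ID c) c).
  by rewrite -[RHS]bigcup_part; apply: eq_bigr => i _; rewrite s'_c'.
by case: ifP => // _; apply: IHM => //; apply: consistent_settle.
Qed.

Lemma parallel_MIS_global_run (M : nat) :
  parallel_MIS e ID part M =
  accepted (global_run e ID M (Classes set0 set0 [set: V])).
Proof.
rewrite -[RHS]bigcup_part; apply: eq_bigr => i _.
rewrite (@run_distribute M (Classes set0 set0 [set: V])) //.
  by rewrite /consistent -setI_eq0 set0I.
by move=> j; congr ProcState; apply: classes_eq; rewrite /= ?setI0 ?setIT.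
Qed.

Lemma eq_global_run (ID' : V -> nat) (M : nat) (c : classes V) :
  ID =1 ID' -> global_run e ID M c = global_run e ID' M c.
Proof.
move=> eqID; have eq_min c' : local_minima e ID c' = local_minima e ID' c'.
  apply/setP => v; rewrite !inE; congr (_ && _).
  by apply: eq_forallb => w; rewrite !eqID.
by elim: M c => //= M IHM c; rewrite eq_min IHM.
Qed.

End Graph.

(** * Invariance and injectivity of the global index *)

Section GlobalIndex.

Variables (R : realType) (d N : nat) (F : {fset front R d}).
Variables (box : front R d -> 'I_N) (Id : local_index R d N).
Hypotheses (hId : is_local_index F box Id).
Hypothesis hGI : GI_decomposition_invariant F box Id.

Lemma trivial_decomposition_cover : \bigcup_(i < 1) [set: 'I_N] = [set: 'I_N].
Proof. by rewrite big_ord1. Qed.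

Lemma trivial_decomposition_disjoint (i j : 'I_1) :
  i != j -> [disjoint [set: 'I_N] & [set: 'I_N]].
Proof. by rewrite !ord1. Qed.

Lemma trivial_decomposition_order (i j : 'I_1) (k l : 'I_N) :
  k \in [set: 'I_N] -> l \in [set: 'I_N] -> (i < j)%N -> (k < l)%N.
Proof. by rewrite !ord1. Qed.

Definition trivial_decomposition : decomposition N 1 :=
  Decomposition trivial_decomposition_cover trivial_decomposition_disjoint
    trivial_decomposition_order.

Lemma front_part_trivial : front_part F box trivial_decomposition ord0 = F.
Proof. by apply/fsetP => f; rewrite !inE /= ?inE ?andbT. Qed.

Lemma GI_trivial (n : nat) (D : decomposition N n) (f : front R d) :
  f \in F -> GI F box Id D f = Id trivial_decomposition f ord0.
Proof.
move=> fF; rewrite /GI; case: pickP => [k fk|noPart].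
  rewrite (hGI (D' := trivial_decomposition) (l := ord0) fk).
    by rewrite /shifted_index big_pred0 ?addn0.
  by rewrite front_part_trivial.
(* The groups cover all boxes, so the dummy value [0] of [GI] does not occur on [F]. *)
have : box f \in \bigcup_(i < n) D i by rewrite group_cover inE.
by case/bigcupP => k _ fk; have := noPart k; rewrite !inE /= fF fk.
Qed.

Lemma GI_inj (n : nat) (D : decomposition N n) :
  {in F &, injective (GI F box Id D)}.
Proof.
move=> f g fF gF; rewrite !GI_trivial //.
by have [_ + _] := hId trivial_decomposition ord0;
   rewrite front_part_trivial; apply.
Qed.

End GlobalIndex.

(** * The graph of candidate elements and its partition *)

Section CandidateGraph.

Variables (R : realType) (d : nat) (F : {fset front R d}).
Variable adv : front R d -> option 'rV[R]_d.

Lemma dist_sym (p q : 'rV[R]_d) : dist p q = dist q p.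
Proof.
by congr Num.sqrt; apply: eq_bigr => i _; rewrite -opprB sqrrN.
Qed.

Lemma edge_irr (h : front R d -> R) : irreflexive (edge F adv h).
Proof. by move=> v; rewrite /edge eqxx. Qed.

Lemma edge_sym (h : front R d -> R) : symmetric (edge F adv h).
Proof. by move=> v w; rewrite /edge eq_sym dist_sym addrC. Qed.

Lemma vertexP (v : vertices F adv) :
  (val v).1 \in F /\ adv (val v).1 = Some (val v).2.
Proof.
have := valP v; rewrite inE /= mem_pmap => /mapP[f fF].
by case advf: (adv f) => [p|//] [->].
Qed.

(** The point of a vertex is determined by its front through [adv]. *)
Lemma vertex_front_inj : injective (fun v : vertices F adv => (val v).1).
Proof.
move=> v w /= vw; apply: val_inj.
have [_ advv] := vertexP v; have [_ advw] := vertexP w.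
move: advv; rewrite vw advw => -[/esym vw2].
by rewrite [LHS]surjective_pairing [RHS]surjective_pairing vw vw2.
Qed.

Variables (N : nat) (box : front R d -> 'I_N).
Variables (n : nat) (D : decomposition N n).

Lemma in_vertex_part (v : vertices F adv) (i : 'I_n) :
  (v \in vertex_part F box adv D i) = (box (val v).1 \in D i).
Proof. by have [vF _] := vertexP v; rewrite !inE /= vF. Qed.

Lemma vertex_part_cover :
  \bigcup_(i < n) vertex_part F box adv D i = [set: vertices F adv].
Proof.
apply/setP => v; rewrite inE.
have : box (val v).1 \in \bigcup_(i < n) D i by rewrite group_cover inE.
by case/bigcupP => i _ vi; apply/bigcupP; exists i; rewrite ?in_vertex_part.
Qed.

Lemma vertex_part_disjoint (i j : 'I_n) :
  i != j -> [disjoint vertex_part F box adv D i & vertex_part F box adv D j].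
Proof.
move=> /(group_disjoint D) Dij; rewrite -setI_eq0; apply/eqP/setP => v.
rewrite in_setI !in_vertex_part in_set0.
by case: (boolP (_ \in D i)) => // /(disjointFr Dij) ->.
Qed.

End CandidateGraph.

Theorem theorem1 (R : realType) (d : nat) (hd : d = 2%N \/ d = 3%N)
  (N : nat) (F : {fset front R d}) (box : front R d -> 'I_N)
  (Id : local_index R d N) (hId : is_local_index F box Id)
  (hGI : GI_decomposition_invariant F box Id)
  (adv : front R d -> option ('rV[R]_d))
  (h : front R d -> R) (hpos : {in F, forall f, 0 < h f})
  (M n m : nat) (D : decomposition N n) (D' : decomposition N m) :
  returned_set F box Id adv h M D = returned_set F box Id adv h M D'.
Proof.
pose ID (k : nat) (D0 : decomposition N k) (v : vertices F adv) :=
  GI F box Id D0 (val v).1.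
have ID_inj k (D0 : decomposition N k) : injective (ID k D0).
  move=> v w /(GI_inj hId hGI) vw; apply: vertex_front_inj.
  by apply: vw; [have [] := vertexP v | have [] := vertexP w].
have eqID : ID n D =1 ID m D'.
  by move=> v; have [vF _] := vertexP v; rewrite /ID !GI_trivial.
(* In the global run the decomposition enters only through [ID]. *)
have returnedE k (D0 : decomposition N k) :
  returned_set F box Id adv h M D0 =
  accepted (global_run (edge F adv h) (ID k D0) M
             (Classes set0 set0 [set: vertices F adv])).
  apply: parallel_MIS_global_run => //.
  - exact: edge_irr.
  - exact: edge_sym.
  - exact: ID_inj.
  - exact: vertex_part_cover.
  - exact: vertex_part_disjoint.
by rewrite !returnedE (eq_global_run _ _ _ eqID).
Qed.
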